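(* Let $\beta,b\in\mathbb{N}^m$ with $\beta\neq0$, and $A=[A_1|\cdots|A_n]\in\mathbb{N}^{m\times n}$ be such that $\beta\geq b$ and $\beta\geq A_k$ for every $1\leq k\leq n$, and let $c\in\mathbb{R}^n$. Define $$J_\bullet:=\min_x\{c'x: Ax=b,\ x\in\mathbb{N}^n\},$$ and, for $1\leq\ell\leq|\beta|$, $$J_\ell:=\min_{\mathbf{y}}\Big\{c'E\,\mathbf{y}:\ \mathbf{y}\in\mathbb{R}^p,\ \mathbf{y}\geq0,\ b^z=\mathbf{y}'A^{(z)}\ \text{ for all } z\in\mathbb{N}^m \text{ with } z\leq\beta,\ 1\leq|z|\leq\ell\Big\}.$$ Then $J_1\leq J_2\leq\cdots\leq J_{|\beta|}$ and $J_{|\beta|}=J_\bullet$.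
   Context: $\mathbb{N}=\{0,1,2,\dots\}$; prime denotes transpose; inequalities between vectors are entrywise; $A_k$ is the $k$-th column of $A$ and $A_{j;k}$ its $j$-th entry; $|z|:=z_1+\cdots+z_m$ for $z\in\mathbb{N}^m$. For $w,z\in\mathbb{N}^m$, $w^z:=w_1^{z_1}\cdots w_m^{z_m}$ with $0^0=1$. Set $p:=\sum_{k=1}^n\prod_{j=1}^m(1+\beta_j-A_{j;k})$; vectors in $\mathbb{R}^p$ are indexed by pairs $(k,u)$ with $1\leq k\leq n$, $u\in\mathbb{N}^m$, $u\leq\beta-A_k$. $E\in\mathbb{N}^{n\times p}$ is the matrix with $(E\mathbf{y})_k=\sum_{u\leq\beta-A_k}y[k,u]$ for $\mathbf{y}=(y[k,u])\in\mathbb{R}^p$. For $z\in\mathbb{N}^m$, $z\leq\beta$, the vector $A^{(z)}\in\mathbb{N}^p$ is given by $A^{(z)}[k,u]:=(u+A_k)^z-u^z$. Minima are taken in the extended reals as infima: the value is $+\infty$ if the problem is infeasible and $-\infty$ if it is unbounded below. *)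

(* Defs.v *)
From HB Require Import structures.
From mathcomp Require Import all_boot all_order all_algebra.
From mathcomp Require Import all_classical all_reals ereal.

Set Implicit Arguments.
Unset Strict Implicit.
Unset Printing Implicit Defensive.
Import Order.TTheory GRing.Theory Num.Theory.
Local Open Scope ring_scope.

(* Elements of N^m are column vectors over the semiring nat. *)

Definition mdeg_cv (m : nat) (z : 'cV[nat]_m) : nat := (\sum_j z j 0%R)%N.

(* ssrnat's expn satisfies 0 ^ 0 = 1. *)
Definition mpow (m : nat) (w z : 'cV[nat]_m) : nat :=
  (\prod_j w j 0%R ^ z j 0%R)%N.

Definition lecv (m : nat) (w z : 'cV[nat]_m) : Prop :=
  forall j, (w j 0%R <= z j 0%R)%N.

Definition nat_mx (R : pzSemiRingType) (m n : nat) (M : 'M[nat]_(m, n)) :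
  'M[R]_(m, n) := map_mx (fun a : nat => a%:R) M.

(* The u in N^m with u <= beta - A_k; the coordinate u_j ranges over
   {0, ..., beta_j - A_{j;k}}, the subtraction being exact when A_k <= beta. *)
Definition box (m n : nat) (A : 'M[nat]_(m, n)) (beta : 'cV[nat]_m)
  (k : 'I_n) : finType := {dffun forall j : 'I_m, 'I_(beta j 0%R - A j k)%N.+1}.

Definition box_cv (m n : nat) (A : 'M[nat]_(m, n)) (beta : 'cV[nat]_m)
  (k : 'I_n) (u : box A beta k) : 'cV[nat]_m := \col_j (u j : nat).

Definition pairs (m n : nat) (A : 'M[nat]_(m, n)) (beta : 'cV[nat]_m) :
  finType := {k : 'I_n & box A beta k}.

(* Defined as the number of pairs (k, u); dim_pairsE gives the closed form. *)
Definition dim_pairs (m n : nat) (A : 'M[nat]_(m, n)) (beta : 'cV[nat]_m) :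
  nat := #|pairs A beta|.

(* The position of (k, u) in a vector of length dim_pairs A beta; its inverse
   is enum_val. *)
Definition pos (m n : nat) (A : 'M[nat]_(m, n)) (beta : 'cV[nat]_m)
  (k : 'I_n) (u : box A beta k) : 'I_(dim_pairs A beta) :=
  enum_rank (Tagged (box A beta) u : pairs A beta).

(* The 0/1 matrix that sums the entries y[k, u] over u; see Emx_mulE. *)
Definition Emx (m n : nat) (A : 'M[nat]_(m, n)) (beta : 'cV[nat]_m) :
  'M[nat]_(n, dim_pairs A beta) :=
  \matrix_(k, i) (tag (enum_val i : pairs A beta) == k : nat).

(* The truncated subtraction is exact, since u <= u + A_k. *)
Definition Avec (m n : nat) (A : 'M[nat]_(m, n)) (beta z : 'cV[nat]_m) :
  'cV[nat]_(dim_pairs A beta) :=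
  \col_i (let ku := enum_val i : pairs A beta in
          let u := box_cv (tagged ku) in
          mpow (u + col (tag ku) A)%R z - mpow u z)%N.

Definition ip_feasible (m n : nat) (A : 'M[nat]_(m, n)) (b : 'cV[nat]_m) :
  set 'cV[nat]_n := [set x | A *m x = b].

Definition ip_value (R : realType) (m n : nat) (A : 'M[nat]_(m, n))
  (b : 'cV[nat]_m) (c : 'cV[R]_n) : \bar R :=
  ereal_inf [set ((c^T *m nat_mx R x) 0 0)%:E | x in ip_feasible A b].

Definition lp_feasible (R : realType) (m n : nat) (A : 'M[nat]_(m, n))
  (beta b : 'cV[nat]_m) (l : nat) : set 'cV[R]_(dim_pairs A beta) :=
  [set y : 'cV[R]_(dim_pairs A beta) | (forall i, 0 <= y i 0) /\
     (forall z : 'cV[nat]_m, lecv z beta -> (1 <= mdeg_cv z <= l)%N ->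
        (mpow b z)%:R = (y^T *m nat_mx R (Avec A beta z)) 0 0)].

Definition lp_value (R : realType) (m n : nat) (A : 'M[nat]_(m, n))
  (beta b : 'cV[nat]_m) (c : 'cV[R]_n) (l : nat) : \bar R :=
  ereal_inf [set ((c^T *m nat_mx R (Emx A beta) *m y) 0 0)%:E
            | y in @lp_feasible R m n A beta b l].

Lemma dim_pairsE (m n : nat) (A : 'M[nat]_(m, n)) (beta : 'cV[nat]_m) :
  (forall k, lecv (col k A) beta) ->
  dim_pairs A beta = (\sum_k \prod_j (1 + beta j 0%R - A j k))%N.
Proof.
move=> hA; rewrite /dim_pairs card_tagged sumnE big_map big_enum /=.
apply: eq_bigr => k _; rewrite card_dep_ffun foldrE big_map big_enum /=.
apply: eq_bigr => j _; rewrite card_ord.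
by move: (hA k j); rewrite mxE => h; rewrite add1n subSn.
Qed.

Lemma Emx_mulE (R : realType) (m n : nat) (A : 'M[nat]_(m, n))
  (beta : 'cV[nat]_m) (y : 'cV[R]_(dim_pairs A beta)) (k : 'I_n) :
  (nat_mx R (Emx A beta) *m y) k 0 = \sum_(u : box A beta k) y (pos u) 0.
Proof.
rewrite mxE (reindex (@enum_rank (pairs A beta))) /=; last first.
  by exists enum_val => i _; rewrite ?enum_rankK ?enum_valK.
under eq_bigr => i _ do rewrite !mxE enum_rankK.
pose F k' (u : box A beta k') : R := (k' == k)%:R * y (pos u) 0.
transitivity (\sum_(i : pairs A beta) F (tag i) (tagged i)).
  by apply: eq_bigr => -[k' u] _.
rewrite -(sig_big_dep (I := 'I_n) (J := fun k => box A beta k) xpredT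
  (fun _ => xpredT) F) (bigD1 k) //= [X in _ + X]big1 ?addr0.
  by apply: eq_bigr => u _; rewrite /F eqxx mul1r.
by move=> k' /negPf nk; apply: big1 => u _; rewrite /F nk mul0r.
Qed.

Lemma Avec_pos (m n : nat) (A : 'M[nat]_(m, n)) (beta z : 'cV[nat]_m)
  (k : 'I_n) (u : box A beta k) :
  Avec A beta z (pos u) 0
  = (mpow (box_cv u + col k A)%R z - mpow (box_cv u) z)%N.
Proof. by rewrite mxE /pos enum_rankK. Qed.

(* Main.v *)
(* The constraints of order |beta| say that y is a unit flow from 0 to b in the
   graph on {v | v <= beta} with edges u -> u + A_k: monomials v^z, z <= beta,
   span all functions on this box (Lagrange interpolation), so
   f(b) - f(0) = sum y[k,u] (f(u + A_k) - f(u)) for every f.  A solution x of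
   the integer program is a path from 0 to b, hence such a flow of the same
   cost.  Conversely, test a flow against the shortest-path potential
   f(v) = inf {c'x + M (|v| - |Ax|) : Ax <= v}, which satisfies
   f(u + A_k) <= f(u) + c_k, so that f(b) is at most the cost of the flow; for M
   large, f(b) is the value of the integer program.  A null column of negative
   cost makes f infinite, but then the integer program is unbounded below as
   soon as it is feasible, which the case c = 0 of the argument shows. *)

Require Import Defs.
From mathcomp Require Import all_boot all_order all_algebra.
From mathcomp Require Import all_classical all_reals ereal.
From mathcomp Require Import zify ring lra.
Import Order.TTheory GRing.Theory Num.Theory.
Local Open Scope ring_scope.

Set Implicit Arguments.
Unset Strict Implicit.
Unset Printing Implicit Defensive.

(** * Edges of the graph and the conservation law *)

Definition action (m n : nat) (A : 'M[nat]_(m, n)) (beta : 'cV[nat]_m)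
  (i : 'I_(dim_pairs A beta)) : 'I_n := tag (enum_val i : pairs A beta).

Definition source (m n : nat) (A : 'M[nat]_(m, n)) (beta : 'cV[nat]_m)
  (i : 'I_(dim_pairs A beta)) : 'cV[nat]_m :=
  box_cv (tagged (enum_val i : pairs A beta)).

Definition target (m n : nat) (A : 'M[nat]_(m, n)) (beta : 'cV[nat]_m)
  (i : 'I_(dim_pairs A beta)) : 'cV[nat]_m := source i + col (action i) A.

(** With f the indicator of v this is Kirchhoff's law at v: inflow minus outflow equals [v = b] -
    [v = 0]. *)
Definition conserves (R : realType) (m n : nat) (A : 'M[nat]_(m, n))
  (beta b : 'cV[nat]_m) (y : 'cV[R]_(dim_pairs A beta))
  (f : 'cV[nat]_m -> R) : Prop :=
  f b - f 0 = \sum_i y i 0 * (f (target i) - f (source i)).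

Lemma lecv_source (m n : nat) (A : 'M[nat]_(m, n)) (beta : 'cV[nat]_m)
  (i : 'I_(dim_pairs A beta)) : lecv (source i) beta.
Proof.
move=> j; rewrite /source mxE; set u := tagged _.
by have := ltn_ord (u j); lia.
Qed.

Lemma lecv_target (m n : nat) (A : 'M[nat]_(m, n)) (beta : 'cV[nat]_m)
  (A_le_beta : forall k : 'I_n, lecv (col k A) beta)
  (i : 'I_(dim_pairs A beta)) : lecv (target i) beta.
Proof.
move=> j; rewrite /target /source !mxE /action; set u := tagged _.
have := A_le_beta (tag (enum_val i : pairs A beta)) j; rewrite mxE.
by have := ltn_ord (u j); move: (A j _) (u j) => a v; lia.
Qed.

(** * Monomials, degrees, costs and moments *)

Lemma mpow_mono (m : nat) (v w z : 'cV[nat]_m) :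
  lecv v w -> (mpow v z <= mpow w z)%N.
Proof.
move=> vw; apply: leq_prod => j _.
by case: (z j 0%R) => [|e]; rewrite ?expn0 // leq_exp2r.
Qed.

Lemma mpow0 (m : nat) (z : 'cV[nat]_m) : mdeg_cv z != 0%N -> mpow 0 z = 0%N.
Proof.
rewrite /mdeg_cv sum_nat_eq0 => /forallPn[j]; rewrite /= => zj.
by rewrite /mpow (bigD1 j) //= mxE exp0n ?mul0n // lt0n.
Qed.

Lemma mdeg_le (m : nat) (v w : 'cV[nat]_m) :
  lecv v w -> (mdeg_cv v <= mdeg_cv w)%N.
Proof. by move=> vw; apply: leq_sum => j _. Qed.

Lemma mdegD (m : nat) (v w : 'cV[nat]_m) :
  mdeg_cv (v + w) = (mdeg_cv v + mdeg_cv w)%N.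
Proof. by rewrite /mdeg_cv -big_split; apply: eq_bigr => j _; rewrite mxE. Qed.

Lemma mdeg_eq0 (m : nat) (v : 'cV[nat]_m) : mdeg_cv v = 0%N -> v = 0.
Proof.
move/eqP; rewrite /mdeg_cv sum_nat_eq0 => /forallP v0.
by apply/colP => j; rewrite mxE; apply/eqP; exact: (v0 j).
Qed.

Lemma lecv_mdeg_eq (m : nat) (v w : 'cV[nat]_m) :
  lecv v w -> (mdeg_cv w <= mdeg_cv v)%N -> v = w.
Proof.
move=> vw wv; apply/colP => j; apply/eqP; rewrite eqn_leq vw /= leqNgt.
apply: contraL wv => vwj; rewrite -ltnNge /mdeg_cv (bigD1 j) //=.
rewrite [ltnRHS](bigD1 j) //= -addSn; apply: leq_add => //.
by apply: leq_sum => i _.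
Qed.

Lemma ip_costE (R : realType) (n : nat) (c : 'cV[R]_n) (x : 'cV[nat]_n) :
  (c^T *m nat_mx R x) 0 0 = \sum_k c k 0 * (x k 0)%:R.
Proof. by rewrite mxE; apply: eq_bigr => k _; rewrite !mxE. Qed.

Lemma ip_costD_delta (R : realType) (n : nat) (c : 'cV[R]_n)
  (x : 'cV[nat]_n) (k : 'I_n) (N : nat) :
  (c^T *m nat_mx R (x + N *: delta_mx k 0)) 0 0
  = (c^T *m nat_mx R x) 0 0 + c k 0 * N%:R.
Proof.
rewrite !ip_costE (bigD1 k) //= [in RHS](bigD1 k) //= !mxE !eqxx /=.
rewrite -[(N * 1)%R]/(N * 1)%N muln1 natrD mulrDr addrAC.
congr (_ + _ + _); apply: eq_bigr => l lk.
by rewrite !mxE (negPf lk) /= mulr0 addr0.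
Qed.

Lemma lp_costE (R : realType) (m n : nat) (A : 'M[nat]_(m, n))
  (beta : 'cV[nat]_m) (c : 'cV[R]_n) (y : 'cV[R]_(dim_pairs A beta)) :
  (c^T *m nat_mx R (Emx A beta) *m y) 0 0 = \sum_i c (action i) 0 * y i 0.
Proof.
rewrite mxE; apply: eq_bigr => i _; rewrite mxE (bigD1 (action i)) //=.
rewrite !mxE /action eqxx mulr1 big1 ?addr0 // => k kn.
by rewrite !mxE eq_sym (negPf kn) mulr0.
Qed.

Lemma momentE (R : realType) (m n : nat) (A : 'M[nat]_(m, n))
  (beta z : 'cV[nat]_m) (y : 'cV[R]_(dim_pairs A beta)) :
  (y^T *m nat_mx R (Avec A beta z)) 0 0
  = \sum_i y i 0 * ((mpow (target i) z)%:R - (mpow (source i) z)%:R).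
Proof.
rewrite mxE; apply: eq_bigr => i _; rewrite !mxE natrB //.
by apply: mpow_mono => j; rewrite [leqRHS]mxE; exact: leq_addr.
Qed.

(** * From moment constraints to conservation of every function *)

Lemma conserves_mpow (R : realType) (m n : nat) (A : 'M[nat]_(m, n))
  (beta b : 'cV[nat]_m) (y : 'cV[R]_(dim_pairs A beta)) (z : 'cV[nat]_m) :
  lp_feasible b (mdeg_cv beta) y -> lecv z beta ->
  conserves b y (fun v => (mpow v z)%:R).
Proof.
move=> [_ hy] zb; rewrite /conserves.
(* The program has no constraint for z = 0, but the constant 1 is conserved by every y. *)
have [/mdeg_eq0 ->|z0] := eqVneq (mdeg_cv z) 0%N.
  have p1 v : mpow v 0 = 1%N by apply: big1 => j _; rewrite mxE.
  by rewrite !p1 subrr big1 // => i _; rewrite !p1 subrr mulr0.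
by rewrite (mpow0 z0) subr0 hy ?momentE // lt0n z0 mdeg_le.
Qed.

(** Both sides are linear in the test function. Terms with a zero coefficient are exempt because the
    expansion of a polynomial below also lists exponents outside the box. *)
Lemma conserves_sum (R : realType) (m n : nat) (A : 'M[nat]_(m, n))
  (beta b : 'cV[nat]_m) (y : 'cV[R]_(dim_pairs A beta)) (I : finType)
  (a : I -> R) (g : I -> 'cV[nat]_m -> R) :
  (forall t, a t != 0 -> conserves b y (g t)) ->
  conserves b y (fun v => \sum_t a t * g t v).
Proof.
move=> hg; rewrite /conserves -sumrB.
transitivity (\sum_t a t * \sum_i y i 0 * (g t (target i) - g t (source i))).
  apply: eq_bigr => t _; rewrite -mulrBr.
  by have [->|/hg ->] := eqVneq (a t) 0; rewrite ?mul0r.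
under eq_bigr do rewrite mulr_sumr.
rewrite exchange_big; apply: eq_bigr => i _ /=.
by rewrite -sumrB mulr_sumr; apply: eq_bigr => t _; ring.
Qed.

Lemma eq_conserves (R : realType) (m n : nat) (A : 'M[nat]_(m, n))
  (beta b : 'cV[nat]_m) (y : 'cV[R]_(dim_pairs A beta))
  (f g : 'cV[nat]_m -> R) :
  lecv b beta -> (forall k : 'I_n, lecv (col k A) beta) ->
  (forall v, lecv v beta -> f v = g v) -> conserves b y f -> conserves b y g.
Proof.
move=> bb Ab fg; rewrite /conserves !fg // => [->|j]; last by rewrite mxE.
apply: eq_bigr => i _; rewrite !fg //; first exact: lecv_source.
exact: lecv_target.
Qed.

Lemma conserves_prod_poly (R : realType) (m n : nat) (A : 'M[nat]_(m, n))
  (beta b : 'cV[nat]_m) (y : 'cV[R]_(dim_pairs A beta)) (p : 'I_m -> {poly R}) :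
  lecv b beta -> (forall k : 'I_n, lecv (col k A) beta) ->
  lp_feasible b (mdeg_cv beta) y ->
  (forall j, (size (p j) <= (beta j 0%R).+1)%N) ->
  conserves b y (fun v => \prod_j (p j).[(v j 0)%:R]).
Proof.
(* |beta| + 1 exceeds every exponent, so one index type serves all coordinates when the product is
   distributed over the sums. *)
move=> bb Ab hy hp; pose N := (mdeg_cv beta).+1.
have bN j : (beta j 0%R < N)%N.
  by rewrite /N ltnS /mdeg_cv (bigD1 j) //= leq_addr.
pose a (f : {ffun 'I_m -> 'I_N}) : R := \prod_j (p j)`_(f j).
pose e (f : {ffun 'I_m -> 'I_N}) : 'cV[nat]_m := \col_j (f j : nat).
have: conserves b y (fun v => \sum_f a f * (mpow v (e f))%:R).
  (* A nonzero coefficient forces each exponent below the size of [p j], hence to at most beta_j. *)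
  apply: conserves_sum => f /prodf_neq0 nz; apply: conserves_mpow => // j.
  rewrite mxE leqNgt; apply/negP => ltb; have := nz j isT.
  by rewrite nth_default ?eqxx // (leq_trans (hp j)).
apply: eq_conserves => // v _.
under [RHS]eq_bigr => j _ do
  rewrite (horner_coef_wide _ (leq_trans (hp j) (bN j))).
rewrite bigA_distr_bigA; apply: eq_bigr => f _.
rewrite big_split /=; congr (_ * _); rewrite /mpow natr_prod.
by apply: eq_bigr => j _; rewrite natrX mxE.
Qed.

(** The Lagrange basis polynomial for the nodes 0, ..., d; the sigma type lets a whole family of
    them be projected out. *)
Lemma nat_indicator_poly (R : realType) (d w : nat) : (w <= d)%N ->
  {p : {poly R} | (size p <= d.+1)%N &
    forall v, (v <= d)%N -> p.[v%:R] = (v == w)%:R}.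
Proof.
move=> wd; pose s := [seq i <- iota 0 d.+1 | i != w].
pose q : {poly R} := \prod_(i <- s) ('X - (i%:R)%:P).
have hq v : q.[v%:R] = \prod_(i <- s) (v%:R - i%:R).
  by rewrite /q horner_prod; apply: eq_bigr => i _; rewrite hornerXsubC.
have qw : q.[w%:R] != 0.
  rewrite hq prodf_seq_neq0; apply/allP => i; rewrite mem_filter => /andP[iw _].
  by rewrite /= subr_eq0 eqr_nat eq_sym.
exists (q.[w%:R]^-1 *: q).
  rewrite (leq_trans (size_scale_leq _ _)) // size_prod_XsubC ltnS.
  (* Removing w from the d + 1 nodes leaves d linear factors. *)
  have := count_predC (pred1 w) (iota 0 d.+1).
  rewrite (count_uniq_mem _ (iota_uniq 0 d.+1)) mem_iota size_iota add0n ltnS wd.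
  by rewrite add1n size_filter => -[cd]; rewrite -[leqRHS]cd.
move=> v vd; rewrite hornerZ; have [->|vw] := eqVneq v w; first exact: mulVf.
have /eqP -> : q.[v%:R] == 0; last by rewrite mulr0.
rewrite hq prodf_seq_eq0; apply/hasP; exists v; last by rewrite /= subrr.
by rewrite mem_filter vw mem_iota.
Qed.

Lemma lp_feasible_conserves (R : realType) (m n : nat) (A : 'M[nat]_(m, n))
  (beta b : 'cV[nat]_m) (y : 'cV[R]_(dim_pairs A beta)) (f : 'cV[nat]_m -> R) :
  lecv b beta -> (forall k : 'I_n, lecv (col k A) beta) ->
  lp_feasible b (mdeg_cv beta) y -> conserves b y f.
Proof.
move=> bb Ab hy; pose W := {dffun forall j : 'I_m, 'I_(beta j 0%R).+1}.
pose L j (w : 'I_(beta j 0%R).+1) := nat_indicator_poly R (ltnSE (ltn_ord w)).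
pose p j (w : 'I_(beta j 0%R).+1) : {poly R} := s2val (L j w).
have sp j (w : 'I_(beta j 0%R).+1) : (size (p j w) <= (beta j 0%R).+1)%N.
  exact: s2valP (L j w).
have pE j (w : 'I_(beta j 0%R).+1) v :
    (v <= beta j 0%R)%N -> (p j w).[v%:R] = (v == w)%:R.
  exact: (s2valP' (L j w)).
(* Tensor products of Lagrange polynomials interpolate f on the box. *)
have: conserves b y (fun v => \sum_(w : W) f (\col_j (w j : nat)) *
    \prod_j (p j (w j)).[(v j 0)%:R]).
  by apply: conserves_sum => w _; apply: conserves_prod_poly => // j; apply: sp.
apply: eq_conserves => // v vb.
(* [w0] is v as a grid index, exact since v <= beta; only its term survives. *)
pose w0 : W := [ffun j => inord (v j 0)].
have w0E j : w0 j = v j 0 :> nat by rewrite ffunE inordK // ltnS.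
rewrite (bigD1 w0) //= [X in f X](_ : _ = v); last first.
  by apply/colP => j; rewrite mxE w0E.
rewrite [X in f v * X]big1 ?mulr1 ?[X in _ + X]big1 ?addr0 //.
  move=> w ww0; have [j wj] : exists j, w j != w0 j.
    apply/existsP; apply: contraR ww0 => /existsPn h; apply/eqP/ffunP => j.
    by apply/eqP; move: (h j); rewrite negbK.
  rewrite (bigD1 j) //= pE // -w0E (inj_eq val_inj) eq_sym (negPf wj).
  by rewrite mul0r mulr0.
by move=> j _; rewrite pE // w0E eqxx.
Qed.

(** * Weak duality and the shortest-path potential *)

(** The condition on f is dual feasibility: no edge raises the potential by more than its cost. *)
Lemma weak_duality (R : realType) (m n : nat) (A : 'M[nat]_(m, n))
  (beta b : 'cV[nat]_m) (c : 'cV[R]_n) (y : 'cV[R]_(dim_pairs A beta))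
  (f : 'cV[nat]_m -> R) :
  (forall i, 0 <= y i 0) -> conserves b y f ->
  (forall v k, f (v + col k A) <= f v + c k 0) ->
  f b - f 0 <= (c^T *m nat_mx R (Emx A beta) *m y) 0 0.
Proof.
move=> y0 -> hf; rewrite lp_costE; apply: ler_sum => i _.
by rewrite mulrC ler_wpM2r // lerBlDl hf.
Qed.

Lemma mdeg_mulmx (m n : nat) (A : 'M[nat]_(m, n)) (x : 'cV[nat]_n) :
  mdeg_cv (A *m x) = (\sum_k mdeg_cv (col k A) * x k 0%R)%N.
Proof.
rewrite /mdeg_cv; under eq_bigr do rewrite mxE.
rewrite exchange_big; apply: eq_bigr => k _ /=.
by rewrite big_distrl; apply: eq_bigr => j _; rewrite mxE.
Qed.

(** A nonzero column has degree at least 1, so its cost per unit of degree is at least minus the sum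
    of all |c_k|; a null column costs at least 0. *)
Lemma ip_cost_lb (R : realType) (m n : nat) (A : 'M[nat]_(m, n))
  (c : 'cV[R]_n) (x : 'cV[nat]_n) :
  (forall k, col k A = 0 -> 0 <= c k 0) ->
  - ((\sum_k `|c k 0|) * (mdeg_cv (A *m x))%:R) <= (c^T *m nat_mx R x) 0 0.
Proof.
move=> hc; rewrite ip_costE mdeg_mulmx natr_sum mulr_sumr -sumrN.
apply: ler_sum => k _; rewrite natrM mulrA -mulNr ler_wpM2r ?ler0n //.
have C0 : 0 <= \sum_k `|c k 0| by exact: sumr_ge0.
have [/mdeg_eq0/hc|] := eqVneq (mdeg_cv (col k A)) 0%N.
  by apply: le_trans; rewrite oppr_le0 mulr_ge0.
rewrite -lt0n -(ler1n R) => d1; rewrite lerNl.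
apply: (@le_trans _ _ (\sum_k `|c k 0|)); last by rewrite ler_peMr.
apply: (@le_trans _ _ `|c k 0|); first by rewrite -normrN ler_norm.
by rewrite (bigD1 k) //= lerDl sumr_ge0.
Qed.

(* The costs of reaching v when the unit columns are added at price M, so that
   every v is reachable. *)
Definition slack_costs (R : realType) (m n : nat) (A : 'M[nat]_(m, n))
  (c : 'cV[R]_n) (M : R) (v : 'cV[nat]_m) : set R :=
  [set (c^T *m nat_mx R x) 0 0 + M * (mdeg_cv v - mdeg_cv (A *m x))%N%:R
  | x in [set x | lecv (A *m x) v]].

Lemma slack_costs_neq0 (R : realType) (m n : nat) (A : 'M[nat]_(m, n))
  (c : 'cV[R]_n) (M : R) (v : 'cV[nat]_m) :
  (slack_costs A c M v !=set0)%classic.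
Proof. by eexists; exists 0 => // j; rewrite mulmx0 mxE. Qed.

(** With nonemptiness, this makes [inf] a true infimum and not a default value. *)
Lemma slack_costs_lb (R : realType) (m n : nat) (A : 'M[nat]_(m, n))
  (c : 'cV[R]_n) (M : R) (v : 'cV[nat]_m) :
  0 <= M -> (forall k, col k A = 0 -> 0 <= c k 0) ->
  lbound (slack_costs A c M v) (- ((\sum_k `|c k 0|) * (mdeg_cv v)%:R)).
Proof.
move=> M0 hc _ [x /= xv <-]; rewrite -[leLHS]addr0.
rewrite lerD ?mulr_ge0 //; apply: le_trans (ip_cost_lb x hc).
by rewrite lerN2 ler_wpM2l ?sumr_ge0 // ler_nat mdeg_le.
Qed.

(** Adding one use of column k to x and A_k to v keeps the slack |v| - |A x|, so only c_k is
    paid. *)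
Lemma inf_slack_step (R : realType) (m n : nat) (A : 'M[nat]_(m, n))
  (c : 'cV[R]_n) (M : R) (v : 'cV[nat]_m) (k : 'I_n) :
  0 <= M -> (forall k, col k A = 0 -> 0 <= c k 0) ->
  inf (slack_costs A c M (v + col k A)) <= inf (slack_costs A c M v) + c k 0.
Proof.
move=> M0 hc; rewrite -lerBlDr; apply: lb_le_inf => [|_ [x /= xv <-]].
  exact: slack_costs_neq0.
rewrite lerBlDr; apply: ge_inf; first by eexists; exact: slack_costs_lb.
have xkE : A *m (x + delta_mx k 0) = A *m x + col k A.
  by rewrite mulmxDr -colE.
exists (x + delta_mx k 0).
  by move=> j /=; rewrite xkE [leqLHS]mxE [leqRHS]mxE; apply: leq_add.
rewrite xkE !mdegD subnDr addrAC; congr (_ + _).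
by rewrite -[delta_mx k 0]scale1r ip_costD_delta mulr1.
Qed.

Lemma inf_slack_le_lp (R : realType) (m n : nat) (A : 'M[nat]_(m, n))
  (beta b : 'cV[nat]_m) (c : 'cV[R]_n) (y : 'cV[R]_(dim_pairs A beta)) (M : R) :
  lecv b beta -> (forall k : 'I_n, lecv (col k A) beta) ->
  (forall k, col k A = 0 -> 0 <= c k 0) ->
  lp_feasible b (mdeg_cv beta) y -> 0 <= M ->
  inf (slack_costs A c M b) <= (c^T *m nat_mx R (Emx A beta) *m y) 0 0.
Proof.
(* x = 0 gives f 0 <= 0, so the bound on f b - f 0 passes to f b. *)
move=> bb Ab hc hy M0; have f0 : inf (slack_costs A c M 0) <= 0.
  apply: ge_inf; first by eexists; exact: slack_costs_lb.
  exists 0 => [j|]; first by rewrite /= mulmx0.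
  by rewrite ip_costE mulmx0 subnn mulr0 addr0 big1 // => k _; rewrite mxE mulr0.
have := weak_duality (c := c) hy.1
  (lp_feasible_conserves (fun v => inf (slack_costs A c M v)) bb Ab hy).
by move/(_ (fun v k => inf_slack_step v k M0 hc)) => /= fb; lra.
Qed.

(** * Flows cost at least the integer value *)

(** With c = 0 and M = 1 the potential of b is the least slack |b| - |A x|. Without a solution it is
    at least 1, but the flow, of cost 0, bounds it by 0. *)
Lemma lp_feasible_ip_feasible (R : realType) (m n : nat) (A : 'M[nat]_(m, n))
  (beta b : 'cV[nat]_m) (y : 'cV[R]_(dim_pairs A beta)) :
  lecv b beta -> (forall k : 'I_n, lecv (col k A) beta) ->
  lp_feasible b (mdeg_cv beta) y -> exists x, A *m x = b.
Proof.
move=> bb Ab hy; apply: contrapT => nx.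
have hc k : col k A = 0 -> 0 <= (0 : 'cV[R]_n) k 0 by rewrite mxE.
have := inf_slack_le_lp bb Ab hc hy ler01; rewrite trmx0 !mul0mx mxE.
apply/negP; rewrite -ltNge; apply: lt_le_trans ltr01 _.
apply: lb_le_inf => [|_ [x /= xb <-]]; first exact: slack_costs_neq0.
rewrite trmx0 mul0mx mxE add0r mul1r ler1n subn_gt0 ltnNge; apply/negP => le.
by apply: nx; exists x; exact: lecv_mdeg_eq.
Qed.


Lemma ip_le_lp (R : realType) (m n : nat) (A : 'M[nat]_(m, n))
  (beta b : 'cV[nat]_m) (c : 'cV[R]_n) (y : 'cV[R]_(dim_pairs A beta)) :
  lecv b beta -> (forall k : 'I_n, lecv (col k A) beta) ->
  lp_feasible b (mdeg_cv beta) y ->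
  (ip_value A b c <= ((c^T *m nat_mx R (Emx A beta) *m y) 0 0)%:E)%E.
Proof.
move=> bb Ab hy; have [x0 x0b] := lp_feasible_ip_feasible bb Ab hy.
set V := (_ *m y) 0 0.
pose cost (x : 'cV[nat]_n) := (c^T *m nat_mx R x) 0 0.
have [hc|] := pselect (forall k, col k A = 0 -> 0 <= c k 0); last first.
  move/existsNP => [k /not_implyP[Ak0 /negP]]; rewrite -ltNge => ck.
  (* [N] copies of the null column lower the cost of [x0] by at least [t], hence to at most V. *)
  pose t := `|cost x0| + `|V|; pose N := (Num.trunc (t / - c k 0)).+1.
  have tN : t <= - c k 0 * N%:R.
    by rewrite mulrC -ler_pdivrMr ?oppr_gt0 // ltW // truncnS_gt.
  apply: ge_ereal_inf; exists (cost (x0 + N *: delta_mx k 0))%:E.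
    exists (x0 + N *: delta_mx k 0) => //=.
    by rewrite /ip_feasible /= mulmxDr -scalemxAr -colE Ak0 scaler0 addr0.
  rewrite [cost _]ip_costD_delta -/(cost x0).
  rewrite lee_fin; have := ler_norm (cost x0); have := ler_norm (- V).
  by rewrite normrN /t in tN *; lra.
(* If A x <= b, then x costs at least minus the second term of [M], so one unit of slack already
   makes it no cheaper than [x0]. *)
pose M := `|cost x0| + (\sum_k `|c k 0|) * (mdeg_cv b)%:R.
have C0 : 0 <= (\sum_k `|c k 0|) * (mdeg_cv b)%:R by rewrite mulr_ge0 ?sumr_ge0.
have M0 : 0 <= M by rewrite addr_ge0.
have ipE x : A *m x = b -> (ip_value A b c <= (cost x)%:E)%E.
  by move=> xb; apply: ereal_inf_lbound; exists x.
apply: le_trans (_ : ((inf (slack_costs A c M b))%:E <= V%:E)%E); last first.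
  by rewrite lee_fin; exact: inf_slack_le_lp.
rewrite -ereal_inf_EFin; last 2 first.
- by eexists; exact: slack_costs_lb.
- exact: slack_costs_neq0.
apply/ereal_infP => _ [_ [x /= xb <-] <-].
(* Zero slack means A x = b; with positive slack, [x0] is no more expensive. *)
have [le|lt] := leqP (mdeg_cv b) (mdeg_cv (A *m x)).
  apply: le_trans (ipE _ (lecv_mdeg_eq xb le)) _.
  by rewrite lee_fin lerDl mulr_ge0.
apply: le_trans (ipE _ x0b) _; rewrite lee_fin.
have Ml : M <= M * (mdeg_cv b - mdeg_cv (A *m x))%N%:R.
  by rewrite ler_peMr // ler1n subn_gt0.
have : - ((\sum_k `|c k 0|) * (mdeg_cv b)%:R) <= cost x.
  apply: le_trans (ip_cost_lb x hc).
  by rewrite lerN2 ler_wpM2l ?sumr_ge0 // ler_nat mdeg_le.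
have := ler_norm (cost x0); rewrite -/(cost x) {1}/M in Ml *; lra.
Qed.

(** * Integer solutions as flows, and the conclusion *)

(** Induction on the number |x| of steps. The columns may be taken in any order, since all partial
    sums stay below A x <= beta; the last edge, from A x' to A x, is added to the flow for x'. *)
Lemma path_lp_feasible (R : realType) (m n : nat) (A : 'M[nat]_(m, n))
  (beta : 'cV[nat]_m) (x : 'cV[nat]_n) :
  lecv (A *m x) beta ->
  exists y : 'cV[R]_(dim_pairs A beta),
    [/\ forall i, 0 <= y i 0,
        forall f, conserves (A *m x) y f &
        forall c : 'cV[R]_n,
          (c^T *m nat_mx R (Emx A beta) *m y) 0 0 = (c^T *m nat_mx R x) 0 0].
Proof.
have [s] := ubnP (mdeg_cv x); elim: s x => // s IHs x xs xb.
have [/mdeg_eq0 ->|] := eqVneq (mdeg_cv x) 0%N.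
  exists 0; split=> [i|f|c]; first by rewrite mxE.
    rewrite /conserves mulmx0 subrr big1 // => i _.
    by rewrite mxE mul0r.
  by rewrite lp_costE ip_costE !big1 // => i _; rewrite !mxE mulr0.
rewrite /mdeg_cv sum_nat_eq0 => /forallPn[k]; rewrite /= => xk.
pose x' : 'cV[nat]_n := \col_l (x l 0%R - (l == k))%N.
have xE : x = x' + delta_mx k 0.
  apply/colP => l; rewrite !mxE eqxx andbT.
  by have [->|_] := eqVneq l k; rewrite ?subn0 ?addr0 // [RHS]subnK // lt0n.
have AxE : A *m x = A *m x' + col k A by rewrite xE mulmxDr -colE.
have Ajk j : ((A *m x')%R j 0%R + A j k <= beta j 0%R)%N.
  by have := xb j; rewrite AxE mxE [col k A _ _]mxE.
have [|j|y [y0 fy cy]] := IHs x'.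
- move: xs; rewrite xE mdegD /mdeg_cv [X in (_ + X)%N](bigD1 k) //=.
  by rewrite !mxE !eqxx /=; lia.
- by apply: leq_trans (Ajk j); exact: leq_addr.
(* [inord] is exact here because A x' + A_k <= beta. *)
pose u : box A beta k := [ffun j => inord ((A *m x')%R j 0%R)].
have uE : box_cv u = A *m x'.
  apply/colP => j; rewrite mxE ffunE inordK // ltnS leq_subRL.
    by rewrite addnC.
  by apply: leq_trans (Ajk j); exact: leq_addl.
exists (y + delta_mx (pos u) 0); split=> [i|f|c].
- by rewrite !mxE addr_ge0.
- have := fy f; rewrite /conserves => e.
  under eq_bigr do rewrite mxE mulrDl.
  rewrite big_split /= -e (bigD1 (pos u)) //= big1 => [|i iu].
    rewrite mxE !eqxx mul1r addr0 /target /source /action /pos enum_rankK /=.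
    by rewrite uE AxE; ring.
  by rewrite mxE (negPf iu) mul0r.
- rewrite mulmxDr mxE cy xE lp_costE (bigD1 (pos u)) //= big1 => [|i iu].
    rewrite [delta_mx _ _ _ _]mxE !eqxx mulr1 addr0 /action /pos enum_rankK /=.
    by rewrite -[delta_mx k 0]scale1r ip_costD_delta mulr1.
  by rewrite mxE (negPf iu) mulr0.
Qed.

Theorem corollary10 (R : realType) (m n : nat)
  (beta b : 'cV[nat]_m) (A : 'M[nat]_(m, n)) (c : 'cV[R]_n)
  (beta_neq0 : beta <> 0)
  (b_le_beta : lecv b beta)
  (A_le_beta : forall k : 'I_n, lecv (col k A) beta) :
  (forall l : nat, (1 <= l < mdeg_cv beta)%N ->
     (lp_value A beta b c l <= lp_value A beta b c l.+1)%E) /\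
  lp_value A beta b c (mdeg_cv beta) = ip_value A b c.
Proof.
split=> [l _|].
  (* Raising l adds constraints, so the infimum runs over a smaller set. *)
  apply: ereal_inf_le_tmp; apply: image_subset => y [y0 hy].
  by split=> // z zb /andP[z1 zl]; apply: hy; rewrite // z1 leqW.
apply/eqP; rewrite eq_le; apply/andP; split; apply/ereal_infP; last first.
  by move=> _ [y /= hy <-]; exact: ip_le_lp.
move=> _ [x /= xb <-].
have /path_lp_feasible : lecv (A *m x) beta by rewrite xb.
move=> /(_ R)[y [y0 hy <-]]; apply: ereal_inf_lbound; exists y => //.
(* The constraint for z is conservation of its monomial, which vanishes at 0 because |z| >= 1. *)
split=> // z zb /andP[z1 _]; rewrite momentE -(hy (fun v => (mpow v z)%:R)) xb.
by rewrite mpow0 ?subr0 // -lt0n.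
Qed.
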